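(* Let $n\ge 1$. For integers $i,j$ and a sequence $D=(D(1),\dots,D(n))$ of pairs of integers, let $NC_n(i,j,D)$ denote the number of permutations $\sigma\in\mathfrak{S}_n$ with crossing number $\operatorname{Cr}(\sigma)=i$, nesting number $\operatorname{Ne}(\sigma)=j$, and degree sequence $D_\sigma=D$. Then for all $i,j,D$, \[NC_n(i,j,D)=NC_n(j,i,D).\]
   Context: For $\sigma\in\mathfrak{S}_n$, the arcs of $\sigma$ are the pairs $(a,\sigma(a))$, $1\le a\le n$. An arc is upper if $a\le\sigma(a)$ (this includes loops $a=\sigma(a)$) and lower if $a>\sigma(a)$. A $k$-crossing of $\sigma$ is a set of $k$ arcs $\{(a_i,\sigma(a_i)):1\le i\le k\}$ satisfying either $a_1<a_2<\dots<a_k\le\sigma(a_1)<\sigma(a_2)<\dots<\sigma(a_k)$ (upper $k$-crossing) or $\sigma(a_1)<\sigma(a_2)<\dots<\sigma(a_k)<a_1<a_2<\dots<a_k$ (lower $k$-crossing). A $k$-nesting is a set of $k$ arcs satisfying either $a_1<a_2<\dots<a_k\le\sigma(a_k)<\dots<\sigma(a_2)<\sigma(a_1)$ (upper $k$-nesting) or $\sigma(a_1)<\sigma(a_2)<\dots<\sigma(a_k)<a_k<\dots<a_2<a_1$ (lower $k$-nesting). (Equivalently, a $k$-crossing (resp. $k$-nesting) is a set of $k$ arcs every two of which cross (resp. nest), where two arcs $(a,\sigma(a)),(b,\sigma(b))$ cross if $a<b\le\sigma(a)<\sigma(b)$ or $\sigma(a)<\sigma(b)<a<b$, and nest if $a<b\le\sigma(b)<\sigma(a)$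 or $\sigma(a)<\sigma(b)<b<a$.) The crossing number $\operatorname{Cr}(\sigma)$ is the largest $k$ such that $\sigma$ has a $k$-crossing; the nesting number $\operatorname{Ne}(\sigma)$ is the largest $k$ such that $\sigma$ has a $k$-nesting. The degree sequence of $\sigma$ is $D_\sigma=(D_\sigma(v))_{v=1}^n$, where $D_\sigma(v)=(\text{indegree}(v),\text{outdegree}(v))$ in the directed graph on $\{1,\dots,n\}$ whose edges are the upper arcs $a\to\sigma(a)$ (with $a\le\sigma(a)$); i.e. $D_\sigma(v)=(\mathbf 1[\sigma^{-1}(v)\le v],\ \mathbf 1[v\le\sigma(v)])$. *)

(* Defs.v *)
From mathcomp Require Import all_boot all_order all_fingroup all_algebra.
Set Implicit Arguments. Unset Strict Implicit. Unset Printing Implicit Defensive.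

(* Permutations of {1..n} are modelled as permutations of 'I_n = {0..n-1};
   all definitions only use the order on positions, so the shift is harmless.
   The arc of a is (a, s a). A set A of arcs is identified with the set of
   their starting points a (s determines the arc). *)

Section CrNe.
Variable n : nat.
Implicit Types (s : {perm 'I_n}) (A : {set 'I_n}).

(* a_1<...<a_k <= s(a_1)<...<s(a_k) *)
Definition upper_crossing s A : bool :=
  [forall a in A, forall b in A, ((a < b) ==> (s a < s b)) && (b <= s a)].
(* s(a_1)<...<s(a_k) < a_1<...<a_k *)
Definition lower_crossing s A : bool :=
  [forall a in A, forall b in A, ((a < b) ==> (s a < s b)) && (s b < a)].
(* a_1<...<a_k <= s(a_k)<...<s(a_1) *)
Definition upper_nesting s A : bool :=
  [forall a in A, forall b in A, ((a < b) ==> (s b < s a)) && (b <= s a)].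
(* s(a_1)<...<s(a_k) < a_k<...<a_1 *)
Definition lower_nesting s A : bool :=
  [forall a in A, forall b in A, ((a < b) ==> (s b < s a)) && (s b < a)].

Definition is_crossing s A := upper_crossing s A || lower_crossing s A.
Definition is_nesting s A := upper_nesting s A || lower_nesting s A.

Definition Cr s : nat := \max_(A : {set 'I_n} | is_crossing s A) #|A|.
Definition Ne s : nat := \max_(A : {set 'I_n} | is_nesting s A) #|A|.

Definition degseq s : {ffun 'I_n -> int * int} :=
  [ffun v => (Posz ((s^-1)%g v <= v : nat), Posz (v <= s v : nat))].

Definition NC (i j : int) (D : {ffun 'I_n -> int * int}) : nat :=
  #|[set s : {perm 'I_n} | [&& Posz (Cr s) == i, Posz (Ne s) == j & degseq s == D]]|.
End CrNe.

(* Main.v *)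
Require Import Defs.
From mathcomp Require Import all_boot all_order all_fingroup all_algebra.
From mathcomp Require Import zify.

Set Implicit Arguments. Unset Strict Implicit. Unset Printing Implicit Defensive.

(** The upper arcs of a permutation, and separately the lower ones, form a
    partial permutation matrix in the staircase [x + y < n], in which crossings
    and nestings are the decreasing and increasing chains spanning a rectangle of
    the staircase.  Fomin's growth rule attaches to every corner [(x, y)] a
    partition [lam _ x y] whose first part is the longest increasing chain in
    the rectangle below [(x, y)], and whose number of parts is the longest
    decreasing one.  The rule is invertible, so the partitions on the boundary
    of the staircase determine the filling, and any admissible boundary occurs.
    Transposing the boundary partitions exchanges crossing and nesting numbers;
    it preserves their sizes, hence the row and column sums of the filling,
    that is, the degree sequence. *)

(** * Chains and shadows *)

(* [lis a x y] is the longest increasing chain among the cells [(x', y')] with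
   [x' < x] and [y' < y], provided [a] is a partial permutation matrix. *)
Fixpoint lis (a : nat -> nat -> nat) (x : nat) : nat -> nat :=
  if x is x'.+1 then
    fix row (y : nat) : nat :=
      if y is y'.+1 then maxn (row y') (lis a x' y) + a x' y' else 0
  else fun=> 0.

(* Viennot's shadow: the inner corners of the level lines of [lis a], whose
   outer corners are the points of [a]. *)
Definition shadow (a : nat -> nat -> nat) (x y : nat) : nat :=
  minn (lis a x.+1 y) (lis a x y.+1) - lis a x y.

(** Viennot's geometric form of RSK: part [k], counted from 0, of the shape attached to the corner
    [(x, y)] is read off the [k]-th iterated shadow. *)
Definition lam (a : nat -> nat -> nat) (k : nat) : nat -> nat -> nat :=
  lis (iter k shadow a).

Definition partial_perm (a : nat -> nat -> nat) : Prop :=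
  [/\ forall x y, a x y <= 1,
      forall x y y', 0 < a x y -> 0 < a x y' -> y = y'
    & forall x x' y, 0 < a x y -> 0 < a x' y -> x = x'].

Definition tr (a : nat -> nat -> nat) (x y : nat) : nat := a y x.

Lemma lis0r a x : lis a x 0 = 0.
Proof. by case: x. Qed.

Lemma lisSS a x y :
  lis a x.+1 y.+1 = maxn (lis a x.+1 y) (lis a x y.+1) + a x y.
Proof. by []. Qed.

Lemma lis_tr a x y : lis (tr a) x y = lis a y x.
Proof.
elim: x y => [|x IHx] y; first by rewrite lis0r.
elim: y => [|y IHy]; first by rewrite lis0r.
by rewrite !lisSS IHy IHx maxnC.
Qed.

Lemma shadow_tr a x y : shadow (tr a) x y = shadow a y x.
Proof. by rewrite /shadow !(lis_tr a) minnC. Qed.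

Lemma eq_lis a b : (forall x y, a x y = b x y) -> forall x y, lis a x y = lis b x y.
Proof.
move=> eq_ab; elim=> [//|x IHx]; elim=> [//|y IHy].
by rewrite !lisSS IHy IHx eq_ab.
Qed.

Lemma partial_perm_tr a : partial_perm a -> partial_perm (tr a).
Proof.
move=> [a1 ay ax]; split=> [x y|x y y'|x x' y]; first exact: a1.
- exact: ax.
- exact: ay.
Qed.

Lemma lis_leS a x y : lis a x y <= lis a x.+1 y.
Proof. by case: y => [|y]; rewrite ?lis0r // lisSS; lia. Qed.

Lemma lis_lerS a x y : lis a x y <= lis a x y.+1.
Proof. by rewrite -!(lis_tr a) lis_leS. Qed.

Lemma leq_lis a x x' y y' : x <= x' -> y <= y' -> lis a x y <= lis a x' y'.
Proof.
move=> le_xx' le_yy'; apply: (@leq_trans (lis a x' y)).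
  by apply: (homo_leq leqnn leq_trans (fun x => lis_leS a x y)).
by apply: (homo_leq leqnn leq_trans (fun y => lis_lerS a x' y)).
Qed.

Lemma lis_no_point a x y :
  (forall y', y' < y -> a x y' = 0) -> lis a x.+1 y = lis a x y.
Proof.
elim: y => [|y IHy] a0; first by rewrite !lis0r.
rewrite lisSS a0 // IHy; last by move=> y' lt; apply: a0; lia.
by have := lis_lerS a x y; lia.
Qed.

Lemma lis_point a x y : partial_perm a -> 0 < a x y ->
  [/\ lis a x.+1 y = lis a x y, lis a x y.+1 = lis a x y
    & lis a x.+1 y.+1 = (lis a x y).+1].
Proof.
move=> [a1 ay ax] a_xy.
have e1 : lis a x.+1 y = lis a x y.
  apply: lis_no_point => y' lt; apply/eqP; rewrite -leqn0 leqNgt.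
  by apply/negP => /ay/(_ a_xy); lia.
have e2 : lis a x y.+1 = lis a x y.
  rewrite -!(lis_tr a); apply: lis_no_point => x' lt.
  apply/eqP; rewrite -leqn0 leqNgt; apply/negP.
  by rewrite /tr => /ax/(_ a_xy); lia.
by split=> //; rewrite lisSS e1 e2; have := a1 x y; lia.
Qed.

Lemma lisS_le a x y : partial_perm a -> lis a x.+1 y <= (lis a x y).+1.
Proof.
move=> pa; elim: y => [|y IHy]; first by rewrite !lis0r.
have le := lis_lerS a x y.
have [/(lis_point pa)[_ e1 e2]|] := ltnP 0 (a x y); first by rewrite e1 e2.
by rewrite lisSS; lia.
Qed.

(** A gap between columns [x] and [x.+1] can only be created by a point of column [x], so going down
    it persists until such a point is met. *)
Lemma lis_gap_point a x y y' : y' <= y -> lis a x y < lis a x.+1 y ->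
  (exists2 z, y' <= z < y & 0 < a x z) \/ lis a x y' < lis a x.+1 y'.
Proof.
elim: y => [|y IHy] le gap; first by rewrite !lis0r in gap.
have [lt|ge] := leqP y' y; last by right; have -> : y' = y.+1 by lia.
have [a_gt0|a0] := ltnP 0 (a x y); first by left; exists y; rewrite ?lt ?ltnS /=.
have le_y := lis_lerS a x y.
have {}gap : lis a x y < lis a x.+1 y by rewrite lisSS in gap; lia.
by case: (IHy lt gap) => [[z zP az]|]; [left; exists z => //; lia | right].
Qed.

Lemma lis_gap_point_tr a x x' y : x' <= x -> lis a x y < lis a x y.+1 ->
  (exists2 z, x' <= z < x & 0 < a z y) \/ lis a x' y < lis a x' y.+1.
Proof. by move=> le; rewrite -!(lis_tr a) => /(lis_gap_point le). Qed.

Lemma shadow_gt0 a x y :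
  (0 < shadow a x y) = (lis a x y < lis a x.+1 y) && (lis a x y < lis a x y.+1).
Proof. by rewrite /shadow; lia. Qed.

Lemma shadow_point_below a x y : 0 < shadow a x y ->
  exists2 y', y' < y & 0 < a x y'.
Proof.
rewrite shadow_gt0 => /andP[gap _].
case: (lis_gap_point (leq0n y) gap) => [[z zP az]|]; last by rewrite !lis0r.
by exists z.
Qed.

Lemma shadow_point_left a x y : 0 < shadow a x y ->
  exists2 x', x' < x & 0 < a x' y.
Proof. by rewrite -(shadow_tr a) => /shadow_point_below. Qed.

(** If [y' < y], the only point of column [x] lies below [y'], so the gap at [y] persists down to
    [y'.+1]. There the vertical gap of the shadow at [y'] has already absorbed it. *)
Lemma shadow_col_uniq a x y y' : partial_perm a ->
  0 < shadow a x y -> 0 < shadow a x y' -> y = y'.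
Proof.
move=> pa; wlog lt : y y' / y' < y => [W s s'|s s'].
  by case: (ltngtP y y') => [lt|lt|//]; [symmetry|]; apply: W.
exfalso; have [z lt_z az] := shadow_point_below s'.
have [a1 ay _] := pa.
have a0 w : y' <= w -> a x w = 0.
  move=> le; apply/eqP; rewrite -leqn0 leqNgt; apply/negP => /ay/(_ az); lia.
move: s s'; rewrite !shadow_gt0 => /andP[gap _] /andP[gap1 gap2].
case: (lis_gap_point lt gap) => [[w wP]|]; first by rewrite a0 //; lia.
by rewrite lisSS a0 //; have := lisS_le x y' pa; lia.
Qed.

Lemma partial_perm_shadow a : partial_perm a -> partial_perm (shadow a).
Proof.
move=> pa; split=> [x y|x y y'|x x' y].
- by rewrite /shadow; have := lisS_le x y pa; lia.
- exact: shadow_col_uniq.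
- by rewrite -!(shadow_tr a); apply: shadow_col_uniq (partial_perm_tr pa).
Qed.

(** Discrete intermediate values, without monotonicity of [f]. *)
Lemma first_crossing (f : nat -> nat) i x x' : x <= x' -> f x < i <= f x' ->
  exists2 z, x <= z < x' & f z < i <= f z.+1.
Proof.
elim: x' => [|x' IHx'] le /andP[fx fx'].
  by have e : x = 0 by [lia]; subst x; lia.
have [lei|gei] := leqP i (f x').
  have lex : x <= x' by rewrite leqNgt; apply/negP => ?; have e : x = x'.+1 by [lia]; subst x; lia.
  have [||z zP fz] := IHx'; rewrite ?fx ?lei //.
  by exists z => //; lia.
exists x'; last by rewrite gei.
suff : x != x'.+1 by lia.
by apply/eqP => e; subst x; lia.
Qed.

(** By transposition the first point may be assumed to have level at most that of the second. Along
    the line [y1], [lis a] then reaches the level of the first point somewhere past [x1], and a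
    shadow sits where it does. *)
Lemma shadow_between a x1 y1 x2 y2 : partial_perm a ->
  0 < a x1 y1 -> 0 < a x2 y2 -> x1 < x2 -> y2 < y1 ->
  exists x, exists y, [/\ x1 < x <= x2, y2 < y <= y1 & 0 < shadow a x y].
Proof.
wlog le : a x1 y1 x2 y2 / lis a x1.+1 y1.+1 <= lis a x2.+1 y2.+1.
  move=> W pa a1 a2 lt_x lt_y.
  case: (leqP (lis a x1.+1 y1.+1) (lis a x2.+1 y2.+1)) => [le|/ltnW le].
    exact: W.
  have [||||||y [x [yP xP sP]]] := W (tr a) y2 x2 y1 x1; rewrite ?(lis_tr a) //.
    exact: partial_perm_tr.
  by exists x, y; rewrite -(shadow_tr a).
move=> pa a1 a2 lt_x lt_y.
have [e1 e2 e3] := lis_point pa a1.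
have cross : lis a x1.+1 y1 < lis a x1.+1 y1.+1 <= lis a x2.+1 y1.
  have : lis a x2.+1 y2.+1 <= lis a x2.+1 y1 by apply: leq_lis.
  by lia.
have [|x xP fx] := first_crossing (f := lis a ^~ y1) _ cross; first exact: ltnW.
exists x, y1; split; [lia|lia|rewrite shadow_gt0].
have : lis a x1.+1 y1.+1 <= lis a x y1.+1 by apply: leq_lis; lia.
by move: fx => /=; lia.
Qed.

(** Follow the gap of the first shadow down column [x1] and that of the second leftwards along row
    [y2]. If neither meets a point, both gaps survive at [(x1, y2)], a second shadow in column
    [x1]. *)
Lemma point_between_shadows a x1 y1 x2 y2 : partial_perm a ->
  0 < shadow a x1 y1 -> 0 < shadow a x2 y2 -> x1 < x2 -> y2 < y1 ->
  exists x, exists y, [/\ x1 <= x < x2, y2 <= y < y1 & 0 < a x y].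
Proof.
move=> pa s1 s2 lt_x lt_y.
have := s1; have := s2; rewrite !shadow_gt0 => /andP[_ gap2] /andP[gap1 _].
case: (lis_gap_point (ltnW lt_y) gap1) => [[y yP ay]|{}gap1].
  by exists x1, y; split=> //; lia.
case: (lis_gap_point_tr (ltnW lt_x) gap2) => [[x xP ax]|{}gap2].
  by exists x, y2; split=> //; lia.
have s3 : 0 < shadow a x1 y2 by rewrite shadow_gt0 gap1 gap2.
by have := shadow_col_uniq pa s1 s3; lia.
Qed.

(** * Chains and the parts of the shape *)

Fixpoint inc_chain (a : nat -> nat -> nat) (k X Y : nat) : Prop :=
  if k is k'.+1 then
    exists x, exists y, [/\ x < X, y < Y, 0 < a x y & inc_chain a k' x y]
  else True.

(* Chains of [k] points with increasing [x] in [x0, X[ and decreasing [y] < y0. *)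
Fixpoint dec_chain (a : nat -> nat -> nat) (X k x0 y0 : nat) : Prop :=
  if k is k'.+1 then
    exists x, exists y,
      [/\ x0 <= x < X, y < y0, 0 < a x y & dec_chain a X k' x.+1 y]
  else True.

Lemma inc_chain_mono a k X Y X' Y' : X <= X' -> Y <= Y' ->
  inc_chain a k X Y -> inc_chain a k X' Y'.
Proof.
case: k => [//|k] leX leY [x [y [xP yP ? ?]]].
by exists x, y; split=> //; lia.
Qed.

Lemma dec_chain_mono a X k x0 y0 x1 y1 : x1 <= x0 -> y0 <= y1 ->
  dec_chain a X k x0 y0 -> dec_chain a X k x1 y1.
Proof.
case: k => [//|k] lex ley [x [y [xP yP ? ?]]].
by exists x, y; split=> //; lia.
Qed.

Lemma lis_inc_chain a k X Y : partial_perm a ->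
  k <= lis a X Y <-> inc_chain a k X Y.
Proof.
move=> pa; split; last first.
  elim: k X Y => [//|k IHk] X Y [x [y [xP yP /(lis_point pa)[_ _ e] /IHk le]]].
  by apply: (@leq_trans (lis a x.+1 y.+1)); [rewrite e | apply: leq_lis].
elim: X Y k => [|X IHX] Y k; first by case: k.
elim: Y k => [|Y IHY] k; first by rewrite lis0r; case: k.
have [aXY|a0] := ltnP 0 (a X Y).
  have [_ e1 e2] := lis_point pa aXY; rewrite e2.
  case: k => [//|k] /= le; exists X, Y; split=> //; apply: IHX; lia.
rewrite lisSS => le.
have [/IHY|gt] := leqP k (lis a X.+1 Y); first exact: inc_chain_mono.
have /IHX : k <= lis a X Y.+1 by lia.
exact: inc_chain_mono.
Qed.

(** Each pair of consecutive points has a shadow between them. The half-open ranges of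
    [shadow_between] keep these shadows strictly decreasing, and explain the bound [y.+1]. *)
Lemma dec_chain_shadow a X k x y : partial_perm a -> 0 < a x y ->
  dec_chain a X k x.+1 y -> dec_chain (shadow a) X k x.+1 y.+1.
Proof.
move=> pa; elim: k x y => [//|k IHk] x y a1 [x2 [y2 [x2P y2P a2 ch]]] /=.
have [||x' [y' [x'P y'P s]]] := shadow_between pa a1 a2; [lia|lia|].
exists x', y'; split; [lia|lia|done|].
by apply: dec_chain_mono (IHk _ _ a2 ch); lia.
Qed.

(** Dually, there is a point between consecutive shadows, and one more below the last shadow. *)
Lemma shadow_dec_chain a X k x y : partial_perm a -> x < X ->
  0 < shadow a x y -> dec_chain (shadow a) X k x.+1 y ->
  dec_chain a X k.+1 x y.
Proof.
move=> pa; elim: k x y => [|k IHk] x y ltX s1.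
  by move=> _; have [y' ? ?] := shadow_point_below s1; exists x, y'; rewrite leqnn.
case=> x2 [y2 [x2P y2P s2 ch]].
have [||x' [y' [x'P y'P a']]] := point_between_shadows pa s1 s2; [lia|lia|].
exists x', y'; split; [lia|lia|done|].
have [_ ltX2] := andP x2P.
by apply: dec_chain_mono (IHk _ _ ltX2 s2 ch); lia.
Qed.

(** Taking the shadow shortens the longest decreasing chain by exactly one: in the backward
    direction the extra point lies to the left of the first shadow. *)
Lemma dec_chainS_shadow a X k Y : partial_perm a ->
  dec_chain a X k.+2 0 Y <-> dec_chain (shadow a) X k.+1 0 Y.
Proof.
move=> pa; split=> [[x [y [xP yP a1 ch]]]|[x [y [/andP[_ xP] yP s ch]]]].
  by apply: (@dec_chain_mono _ _ k.+1 x.+1 y.+1) => //; apply: dec_chain_shadow.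
have [x0 ltx0 a0] := shadow_point_left s.
exists x0, y; split; [lia|lia|done|].
by apply: (@dec_chain_mono _ _ k.+1 x y) => //; apply: shadow_dec_chain.
Qed.

Lemma lam_dec_chain a k X Y : partial_perm a ->
  0 < lam a k X Y <-> dec_chain a X k.+1 0 Y.
Proof.
elim: k a => [|k IHk] a pa.
  apply: iff_trans (lis_inc_chain 1 X Y pa) _.
  by split=> -[x [y [xP yP ? _]]]; exists x, y; split.
have -> : lam a k.+1 X Y = lam (shadow a) k X Y by rewrite /lam iterSr.
have e1 := IHk _ (partial_perm_shadow pa); have e2 := dec_chainS_shadow X k Y pa.
exact: iff_trans e1 (iff_sym e2).
Qed.

Lemma partial_perm_iter a k : partial_perm a -> partial_perm (iter k shadow a).
Proof. by move=> pa; elim: k => //= k; apply: partial_perm_shadow. Qed.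

(** * Growth diagrams *)

Lemma lam0r a k x : lam a k x 0 = 0.
Proof. exact: lis0r. Qed.

Lemma lam0l a k y : lam a k 0 y = 0.
Proof. by []. Qed.

(** Fomin's rule is the recursion of [lis] with the shadow unfolded, so it holds by computation. *)
Lemma lamSS a k x y :
  lam a k.+1 x.+1 y.+1 = maxn (lam a k.+1 x.+1 y) (lam a k.+1 x y.+1)
    + (minn (lam a k x.+1 y) (lam a k x y.+1) - lam a k x y).
Proof. by []. Qed.

(** By induction both terms of the maximum in the recursion are at most [lis a x y], and the shadow
    entry adds the minimum minus [lis a x y]. *)
Lemma lis_shadowSS a x y :
  lis (shadow a) x.+1 y.+1 <= minn (lis a x.+1 y) (lis a x y.+1).
Proof.
have lis0l b z : lis b 0 z = 0 by [].
elim: x y => [|x IHx]; elim=> [|y IHy]; rewrite lisSS [shadow a _ _]/shadow.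
- by rewrite !lis0l !lis0r.
- by rewrite !lis0l in IHy *; lia.
- have := IHx 0; have := lis_leS a x.+1 0; rewrite !lis0r; lia.
- have := IHx y.+1; have := lis_leS a x.+1 y.+1; have := lis_lerS a x.+1 y.+1; lia.
Qed.

Lemma lam_strip a k x y : lam a k.+1 x.+1 y <= lam a k x y.
Proof.
case: y => [|y]; first by rewrite !lam0r.
by have := lis_shadowSS (iter k shadow a) x y; rewrite /lam /=; lia.
Qed.

Lemma lam_stripr a k x y : lam a k.+1 x y.+1 <= lam a k x y.
Proof.
case: x => [|x]; first by rewrite !lam0l.
by have := lis_shadowSS (iter k shadow a) x y; rewrite /lam /=; lia.
Qed.

Lemma lam_leS a k x y : lam a k x y <= lam a k x.+1 y.
Proof. exact: lis_leS. Qed.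

Lemma lam_lerS a k x y : lam a k x y <= lam a k x y.+1.
Proof. exact: lis_lerS. Qed.

Lemma lam_antitone a k x y : lam a k.+1 x y <= lam a k x y.
Proof. by apply: leq_trans (lam_strip a k x y); apply: lam_leS. Qed.

Lemma lam_big a k x y : x <= k -> lam a k x y = 0.
Proof.
elim: x k => [//|x IHx] [//|k] le.
by have := lam_strip a k x y; rewrite IHx //; lia.
Qed.

Lemma lam_bigr a k x y : y <= k -> lam a k x y = 0.
Proof.
elim: y k => [|y IHy] [|k] le //; rewrite ?lam0r //.
by have := lam_stripr a k x y; rewrite IHy //; lia.
Qed.

Lemma lam_le_x a k x y : partial_perm a -> lam a k x y <= x.
Proof.
move=> pa; elim: x => [//|x IHx].
by apply: leq_trans (lisS_le _ _ (partial_perm_iter k pa)) _; rewrite ltnS.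
Qed.

(** * Conjugate partitions *)

(* The conjugate of the partition (f 0 >= f 1 >= ...), truncated to K parts. *)
Definition conj_part (K : nat) (f : nat -> nat) (k : nat) : nat :=
  \sum_(i < K) (k < f i).

Lemma conj_le K f k : conj_part K f k <= K.
Proof.
rewrite /conj_part -[X in _ <= X]card_ord -sum1_card; apply: leq_sum => i _.
exact: leq_b1.
Qed.

(** Since [f] is antitone, the indices counted by [conj_part] form an initial segment. *)
Lemma conjP K f k i : (forall j, f j.+1 <= f j) ->
  (i < conj_part K f k) = (i < K) && (k < f i).
Proof.
move=> antif.
have anti j j' : j <= j' -> f j' <= f j.
  by apply: (homo_leq leqnn (fun y x z (h1 : y <= x) (h2 : z <= y) => leq_trans h2 h1)).
elim: K i => [|K IHK] i; first by rewrite /conj_part big_ord0.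
rewrite /conj_part big_ord_recr /= -/(conj_part K f k).
have le := conj_le K f k.
have [kf|kf] := ltnP k (f K).
  have e : conj_part K f k = K.
    apply/eqP; rewrite eqn_leq le leqNgt; apply/negP => lt.
    have := IHK (conj_part K f k); rewrite ltnn lt /= => /esym/negbT.
    by rewrite -leqNgt; have := anti _ _ le; lia.
  rewrite e addn1; case: ltnP => //= lt; apply/esym.
  by apply: leq_trans kf (anti _ _ _).
rewrite addn0 IHK ltnS [i <= K]leq_eqVlt.
by case: (i =P K) => [->|//]; lia.
Qed.

(** Double counting of the cells of the diagram, which fits in a square of side [K]. *)
Lemma sum_conj K f : (forall i, f i <= K) ->
  \sum_(k < K) conj_part K f k = \sum_(k < K) f k.
Proof.
move=> fK; rewrite /conj_part exchange_big /=; apply: eq_bigr => i _.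
transitivity (\sum_(k < K | k < f i) 1).
  by rewrite [RHS]big_mkcond /=; apply: eq_bigr => k _; case: ltnP.
by rewrite (big_ord_narrow (fK i)) sum1_card card_ord.
Qed.

(** * Sizes of the partitions and row sums *)

Definition size_part (K : nat) (M : nat -> nat -> nat -> nat) (x y : nat) : nat :=
  \sum_(k < K) M k x y.

(* Fomin's local rule, written for all parts at once. *)
Definition growth (n : nat) (b : nat -> nat -> nat) (M : nat -> nat -> nat -> nat) :=
  [/\ forall k x, x <= n -> M k x 0 = 0,
      forall k y, y <= n -> M k 0 y = 0,
      forall k x y, x + y < n -> M k x y <= minn (M k x.+1 y) (M k x y.+1),
      forall x y, x + y < n -> M 0 x.+1 y.+1 = maxn (M 0 x.+1 y) (M 0 x y.+1) + b x y
    & forall k x y, x + y < n -> M k.+1 x.+1 y.+1 =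
        maxn (M k.+1 x.+1 y) (M k.+1 x y.+1)
          + (minn (M k x.+1 y) (M k x y.+1) - M k x y)].

Lemma growth_lam n a : growth n a (lam a).
Proof.
split=> [k x _|//|k x y _|//|k x y _]; first exact: lam0r.
- by have := lam_leS a k x y; have := lam_lerS a k x y; lia.
- exact: lamSS.
Qed.

Lemma growth_tr n b M : growth n b M ->
  growth n (tr b) (fun k x y => M k y x).
Proof.
case=> M0r M0l Mm MS MSS; split=> // [k x y lt|x y lt|k x y lt].
- by have := Mm k y x; lia.
- by rewrite MS 1?maxnC // addnC.
- by rewrite MSS 1?maxnC 1?minnC // addnC.
Qed.

Lemma size_part_growth n b M K x y : growth n b M -> x + y < n ->
  (forall x y, x <= n -> y <= n -> M K x y = 0) ->
  size_part K.+1 M x.+1 y.+1 + size_part K.+1 M x y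
  = size_part K.+1 M x.+1 y + size_part K.+1 M x y.+1 + b x y.
Proof.
move=> [_ _ Mm MS MSS] lt MK.
(* Summing the rule over the parts telescopes up to a leftover from the last part. Keeping this term
   lets the induction on [K] run without any vanishing assumption. *)
suff : size_part K.+1 M x.+1 y.+1 + size_part K.+1 M x y
    + (minn (M K x.+1 y) (M K x y.+1) - M K x y)
  = size_part K.+1 M x.+1 y + size_part K.+1 M x y.+1 + b x y.
  by rewrite !MK ?minnn ?addn0 //; lia.
elim: {MK} K => [|K IHK].
  rewrite /size_part !big_ord1 /= MS //; have := Mm 0 x y lt; lia.
rewrite /size_part ![\sum_(k < K.+2) _]big_ord_recr /= -!/(size_part K.+1 _ _ _).
rewrite MSS //; have := Mm K.+1 x y lt; have := Mm K x y lt; lia.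
Qed.

(** The local size identities telescope along row [y], from empty partitions at [x = 0]. Both
    corners at [n - y] lie on the boundary, so boundary sizes determine the row sums. *)
Lemma row_sum_growth n b M K y : growth n b M -> y < n ->
  (forall x y, x <= n -> y <= n -> M K x y = 0) ->
  \sum_(x < n - y) b x y + size_part K.+1 M (n - y) y
  = size_part K.+1 M (n - y) y.+1.
Proof.
move=> gM lty MK.
suff H X : X <= n - y ->
    \sum_(x < X) b x y + size_part K.+1 M X y = size_part K.+1 M X y.+1.
  exact: H.
elim: X => [_|X IHX ltX].
  rewrite big_ord0 /size_part; have [_ M0l _ _ _] := gM.
  by rewrite !big1 // => k _; rewrite M0l //; lia.
have ltXy : X + y < n by lia.
have := size_part_growth gM ltXy MK; have := IHX (ltnW ltX).
by rewrite big_ord_recr /=; lia.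
Qed.

Lemma eq_growth n b b' M M' :
  growth n b M -> growth n b' M' ->
  (forall x y, x + y < n -> b x y = b' x y) ->
  forall k x y, x + y <= n.+1 -> x <= n -> y <= n -> M k x y = M' k x y.
Proof.
move=> [M0r M0l Mm MS MSS] [N0r N0l Nm NS NSS] eq_b; elim=> [|k IHk].
  elim=> [|x IHx]; first by move=> y *; rewrite M0l ?N0l.
  elim=> [|y IHy] *; first by rewrite M0r ?N0r.
  by rewrite MS ?NS ?IHy ?IHx ?eq_b //; lia.
elim=> [|x IHx]; first by move=> y *; rewrite M0l ?N0l.
elim=> [|y IHy] *; first by rewrite M0r ?N0r.
by rewrite MSS ?NSS ?IHy ?IHx ?IHk //; lia.
Qed.

(** * Inverse growth from the boundary *)

(* Fomin's rule solved for the inner corner. *)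
Definition inward (mu nu rho : nat -> nat) (k : nat) : nat :=
  minn (mu k) (nu k) - (rho k.+1 - maxn (mu k.+1) (nu k.+1)).

Lemma growth_inward n b M k x y : growth n b M -> x + y < n ->
  M k x y = inward (M^~ x.+1 ^~ y) (M^~ x ^~ y.+1) (M^~ x.+1 ^~ y.+1) k.
Proof.
by move=> [_ _ Mm _ MSS] lt; rewrite /inward /= MSS //; have := Mm k x y lt; lia.
Qed.

Lemma boundary_inj n a b :
  (forall k x y, n <= x + y <= n.+1 -> lam a k x y = lam b k x y) ->
  forall x y, x + y < n -> a x y = b x y.
Proof.
move=> bd.
(* Induction on the distance to the antidiagonal [x + y = n], stepping inwards by the inverse
   rule. *)
have eq_lam d : forall k x y, x + y <= n.+1 -> n - (x + y) <= d ->
    lam a k x y = lam b k x y.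
  elim: d => [|d IHd] k x y le le_d; first by apply: bd; lia.
  have [ge|lt] := leqP n (x + y); first by apply: bd; lia.
  rewrite (growth_inward _ (growth_lam n a)) //.
  rewrite (growth_inward _ (growth_lam n b)) // /inward /=.
  by rewrite !IHd //; lia.
move=> x y lt.
have := lisSS a x y; have := lisSS b x y; rewrite -![lis _]/(lam _ 0).
rewrite !(eq_lam n 0) //; lia.
Qed.

(** The skew shape [nu / mu] is a horizontal strip. *)
Definition strip (mu nu : nat -> nat) : Prop :=
  forall k, nu k.+1 <= mu k <= nu k.

(** The hypotheses describe a vertical strip, and conjugation makes it horizontal. *)
Lemma strip_conj K mu nu :
  (forall i, mu i <= nu i) -> (forall i, nu i <= (mu i).+1) ->
  strip (conj_part K mu) (conj_part K nu).
Proof.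
move=> le1 le2 k; apply/andP; split; apply: leq_sum => i _.
  by have := le2 i; case: ltnP => // lt1; case: ltnP => //; lia.
by have := le1 i; case: ltnP => // lt1; case: ltnP => //; lia.
Qed.

(* [t] is the distance of [(x, y)] to the outer boundary [x + y = n.+1]. *)
Fixpoint fill (bd : nat -> nat -> nat -> nat) (t k x y : nat) : nat :=
  match t with
  | 0 => bd k x y
  | t'.+1 =>
    match t' with
    | 0 => bd k x y
    | t''.+1 =>
      minn (fill bd t' k x.+1 y) (fill bd t' k x y.+1)
      - (fill bd t'' k.+1 x.+1 y.+1
         - maxn (fill bd t' k.+1 x.+1 y) (fill bd t' k.+1 x y.+1))
    end
  end.

(** The inverse rule preserves the strip conditions, and these make every truncated subtraction
    exact, so the forward rule holds for the filling. *)
Lemma growth_of_boundary n (bd : nat -> nat -> nat -> nat) :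
  (forall x y, x + y = n -> strip (bd^~ x ^~ y) (bd^~ x.+1 ^~ y)) ->
  (forall x y, x + y = n -> strip (bd^~ x ^~ y) (bd^~ x ^~ y.+1)) ->
  (forall k, bd k n 0 = 0) -> (forall k, bd k 0 n = 0) ->
  exists b, exists2 M, growth n b M &
    forall k x y, n <= x + y <= n.+1 -> M k x y = bd k x y.
Proof.
move=> st1 st2 bd0r bd0l.
pose M k x y := fill bd (n.+1 - (x + y)) k x y.
have Mbd k x y : n <= x + y <= n.+1 -> M k x y = bd k x y.
  move=> h; rewrite /M.
  by have [->|->] : n.+1 - (x + y) = 0 \/ n.+1 - (x + y) = 1 by lia.
have MS k x y : x + y < n -> M k x y =
    inward (M^~ x.+1 ^~ y) (M^~ x ^~ y.+1) (M^~ x.+1 ^~ y.+1) k.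
  move=> lt; rewrite /M /inward.
  have -> : n.+1 - (x + y) = (n.-1 - (x + y)).+2 by lia.
  have -> : n.+1 - (x.+1 + y) = (n.-1 - (x + y)).+1 by lia.
  have -> : n.+1 - (x + y.+1) = (n.-1 - (x + y)).+1 by lia.
  by have -> : n.+1 - (x.+1 + y.+1) = n.-1 - (x + y) by lia.
have st d : forall x y, x + y <= n -> n - (x + y) <= d ->
    strip (M^~ x ^~ y) (M^~ x.+1 ^~ y) /\ strip (M^~ x ^~ y) (M^~ x ^~ y.+1).
  elim: d => [|d IHd] x y le le_d.
    split=> k /=; rewrite !Mbd; try lia; [apply: st1|apply: st2]; lia.
  have [ge|lt] := leqP n (x + y).
    split=> k /=; rewrite !Mbd; try lia; [apply: st1|apply: st2]; lia.
  have [||_ s1] := IHd x.+1 y; [lia|lia|].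
  have [||s2 _] := IHd x y.+1; [lia|lia|].
  by split=> k; have := s1 k; have := s2 k; have := s1 k.+1; have := s2 k.+1;
     rewrite /= (MS _ _ _ lt) /inward /=; lia.
have {}st x y : x + y <= n ->
    strip (M^~ x ^~ y) (M^~ x.+1 ^~ y) /\ strip (M^~ x ^~ y) (M^~ x ^~ y.+1).
  by move=> le; apply: (st n); lia.
(* On an axis the partitions increase towards the corner [(n, 0)], where they vanish. *)
have M0r d x : x + d = n -> forall k, M k x 0 = 0.
  elim: d x => [|d IHd] x e k; first by rewrite (_ : x = n) ?Mbd ?bd0r //; lia.
  by have [|s _] := st x 0; [lia|]; have := s k; rewrite /= !(IHd x.+1); lia.
have M0l d y : y + d = n -> forall k, M k 0 y = 0.
  elim: d y => [|d IHd] y e k; first by rewrite (_ : y = n) ?Mbd ?bd0l //; lia.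
  by have [|_ s] := st 0 y; [lia|]; have := s k; rewrite /= !(IHd y.+1); lia.
(* The entry is the rule for the first part, solved for [b x y]. *)
exists (fun x y => M 0 x.+1 y.+1 - maxn (M 0 x.+1 y) (M 0 x y.+1)), M => //.
split=> [k x le|k y le|k x y lt|x y lt|k x y lt].
- by apply: (M0r (n - x)); lia.
- by apply: (M0l (n - y)); lia.
- by have [|s1 s2] := st x y; [lia|]; have := s1 k; have := s2 k; rewrite /=; lia.
- have [|_ s1] := st x.+1 y; [lia|]; have [|s2 _] := st x y.+1; [lia|].
  by have := s1 0; have := s2 0; rewrite /=; lia.
- have [|_ s1] := st x.+1 y; [lia|]; have [|s2 _] := st x y.+1; [lia|].
  have := s1 k; have := s2 k; have := s1 k.+1; have := s2 k.+1.
  by rewrite /= (MS _ _ _ lt) /inward /=; lia.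
Qed.

(** * Transposing the boundary of a staircase filling *)

Definition staircase (n : nat) (a : nat -> nat -> nat) : Prop :=
  forall x y, n <= x + y -> a x y = 0.

Lemma lis_rS_le a x y : partial_perm a -> lis a x y.+1 <= (lis a x y).+1.
Proof. by move=> /partial_perm_tr pa; rewrite -!(lis_tr a) lisS_le. Qed.

Lemma staircase_gt0 n a x y : staircase n a -> 0 < a x y -> x + y < n.
Proof. by move=> sa; case: (ltnP (x + y) n) => // le; rewrite sa. Qed.

Lemma sum_staircase n a y : staircase n a ->
  \sum_(x < n - y) a x y = \sum_(x < n) a x y.
Proof.
move=> sa; rewrite (big_ord_widen n (fun x => a x y)) ?leq_subr //.
rewrite big_mkcond /=; apply: eq_bigr => x _.
by case: ltnP => // ge; rewrite sa //; lia.
Qed.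

Lemma row_sum_le1 n a y : partial_perm a -> \sum_(x < n) a x y <= 1.
Proof.
move=> [a1 _ ax]; case: (pickP (fun x : 'I_n => 0 < a x y)) => [x ax0|a0].
  rewrite (bigD1 x) //= big1 ?addn0 // => z /negP nz; apply/eqP.
  rewrite -leqn0 leqNgt; apply/negP => az; apply: nz.
  by apply/eqP/val_inj; apply: ax az ax0.
by rewrite big1 // => x _; have := a0 x; lia.
Qed.

Lemma row_sum_gt0 n a y : staircase n a ->
  (0 < \sum_(x < n) a x y) <-> exists x, 0 < a x y.
Proof.
move=> sa; split=> [|[x ax]].
  rewrite lt0n sum_nat_eq0 negb_forall => /existsP[x]; rewrite /= -lt0n => ax.
  by exists x.
have ltx : x < n by have := staircase_gt0 sa ax; lia.
by rewrite (bigD1 (Ordinal ltx)) //= addn_gt0 ax.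
Qed.

Lemma row_uniq n b y : staircase n b -> \sum_(x < n) b x y <= 1 ->
  (forall x, b x y <= 1) /\ (forall x x', 0 < b x y -> 0 < b x' y -> x = x').
Proof.
move=> sb le1.
have lt x : 0 < b x y -> x < n by move/(staircase_gt0 sb); lia.
split=> [x|x x' bx bx'].
  have [/lt ltx|] := ltnP 0 (b x y); last lia.
  by move: le1; rewrite (bigD1 (Ordinal ltx)) //=; lia.
have [ltx ltx'] := (lt _ bx, lt _ bx').
apply/eqP/negPn/negP => ne; move: le1.
rewrite (bigD1 (Ordinal ltx)) //= (bigD1 (Ordinal ltx')) /=; first lia.
by rewrite -val_eqE /= eq_sym.
Qed.

Lemma staircase_tr n a : staircase n a -> staircase n (tr a).
Proof. by move=> sa x y le; apply: sa; rewrite addnC. Qed.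

Lemma lam_tr_growth n a : growth n (tr a) (fun k x y => lam a k y x).
Proof. exact: growth_tr (growth_lam n a). Qed.

(** Truncating to [n.+1] parts loses nothing at corners with [x <= n.+1], by [lam_big]. *)
Definition conj_lam n a k x y := conj_part n.+1 (fun i => lam a i x y) k.

Lemma conj_lamP n a k i x y : (i < conj_lam n a k x y) = (i <= n) && (k < lam a i x y).
Proof. by rewrite /conj_lam conjP // => j; apply: lam_antitone. Qed.

(** Conjugation keeps the boundary sizes, so [b] has the row and column sums of [a]. As these are at
    most 1, [b] is again a partial permutation with the same nonempty rows and columns. *)
Lemma transpose_filling n a : partial_perm a -> staircase n a ->
  exists b,
  [/\ partial_perm b, staircase n b,
      forall y, (exists x, 0 < b x y) <-> (exists x, 0 < a x y),
      forall x, (exists y, 0 < b x y) <-> (exists y, 0 < a x y)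
    & forall k x y, n <= x + y <= n.+1 -> lam b k x y = conj_lam n a k x y].
Proof.
move=> pa sa.
have [||k|k|b0 [M gM Mbd]] := @growth_of_boundary n (conj_lam n a).
- move=> x y e; apply: strip_conj => i; first exact: lam_leS.
  exact: lisS_le (partial_perm_iter i pa).
- move=> x y e; apply: strip_conj => i; first exact: lam_lerS.
  exact: lis_rS_le (partial_perm_iter i pa).
- by apply: big1 => i _; rewrite lam0r.
- by apply: big1 => i _; rewrite lam0l.
(* The growth conditions do not constrain [b0] outside the staircase, so it is cut off there. *)
pose b x y := if x + y < n then b0 x y else 0.
have sb : staircase n b by move=> x y le; rewrite /b ltnNge le.
have {}gM : growth n b M.
  by case: gM => *; split=> // x y lt; rewrite /b lt; auto.
have lamb k x y : n <= x + y <= n.+1 -> lam b k x y = conj_lam n a k x y.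
  move=> h.
  (* [eq_growth] requires both coordinates to be at most [n], so the axes, with corners such as
     [(0, n.+1)], are treated apart. *)
  have [->|] := posnP x; first by rewrite lam0l /conj_lam /conj_part big1 // => i _; rewrite lam0l.
  have [->|] := posnP y; first by rewrite lam0r /conj_lam /conj_part big1 // => i _; rewrite lam0r.
  move=> y0 x0; rewrite -Mbd //; apply: eq_growth (growth_lam n b) gM _ _ _ _ _ _ _ => //; lia.
have size_eq x y : n <= x + y <= n.+1 ->
    size_part n.+1 (lam b) x y = size_part n.+1 (lam a) x y.
  move=> h; rewrite /size_part -(@sum_conj n.+1 (fun i => lam a i x y)).
    by apply: eq_bigr => k _; apply: lamb.
  by move=> i; have := lam_le_x i x y pa; lia.
have rows y : \sum_(x < n) b x y = \sum_(x < n) a x y.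
  have [lt|ge] := ltnP y n; last by rewrite !big1 // => x _; rewrite ?sa ?sb //; lia.
  rewrite -(sum_staircase y sb) -(sum_staircase y sa).
  have := row_sum_growth (growth_lam n a) lt (fun x y h _ => lam_big a y h).
  have := row_sum_growth (growth_lam n b) lt (fun x y h _ => lam_big b y h).
  by rewrite !size_eq; lia.
have cols x : \sum_(y < n) b x y = \sum_(y < n) a x y.
  have [lt|ge] := ltnP x n; last by rewrite !big1 // => y _; rewrite ?sa ?sb //; lia.
  have := sum_staircase x (staircase_tr sa).
  have := sum_staircase x (staircase_tr sb); rewrite /tr => <- <-.
  have := row_sum_growth (lam_tr_growth n a) lt (fun x y h _ => lam_bigr a y h).
  have := row_sum_growth (lam_tr_growth n b) lt (fun x y h _ => lam_bigr b y h).
  rewrite /tr.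
  have e u v : n <= u + v <= n.+1 -> size_part n.+1 (fun k x y => lam b k y x) u v
      = size_part n.+1 (fun k x y => lam a k y x) u v.
    by move=> h; apply: (size_eq v u); lia.
  by rewrite !e; lia.
have row1 y : \sum_(x < n) b x y <= 1 by rewrite rows row_sum_le1.
have col1 x : \sum_(y < n) tr b y x <= 1.
  by rewrite /tr cols; apply: (row_sum_le1 n x (partial_perm_tr pa)).
exists b; split=> //.
- split=> [x y|x y y'|x x' y]; first by have [->] := row_uniq sb (row1 y).
    by have [_] := row_uniq (staircase_tr sb) (col1 x); apply.
  by have [_] := row_uniq sb (row1 y); apply.
- move=> y; have ha := row_sum_gt0 y sa; have hb := row_sum_gt0 y sb.
  by rewrite rows in hb; exact: iff_trans (iff_sym hb) ha.
- move=> x; have ha := row_sum_gt0 x (staircase_tr sa).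
  have hb := row_sum_gt0 x (staircase_tr sb).
  by rewrite /tr cols in hb; exact: iff_trans (iff_sym hb) ha.
Qed.

(** * Point matrices and permutations *)

Lemma eq_shadow a b : (forall x y, a x y = b x y) ->
  forall x y, shadow a x y = shadow b x y.
Proof. by move=> e x y; rewrite /shadow !(eq_lis e). Qed.

Lemma eq_lam a b : (forall x y, a x y = b x y) ->
  forall k x y, lam a k x y = lam b k x y.
Proof.
by move=> e k; apply: eq_lis; elim: k => //= k; apply: eq_shadow.
Qed.

Lemma lt_bigmax (T : finType) (P : pred T) (F : T -> nat) k :
  (k < \max_(i | P i) F i) <-> exists2 i, P i & k < F i.
Proof.
split=> [|[i Pi lt]]; last exact: leq_trans lt (leq_bigmax_cond _ Pi).
have [/existsP[i /andP[Pi lt]]|] := boolP [exists i, P i && (k < F i)].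
  by exists i.
rewrite negb_exists => /forallP none; rewrite ltnNge => /negP[].
apply/bigmax_leqP => i Pi; have := none i; rewrite Pi /=; lia.
Qed.

Section PointMatrix.
Variables (n : nat) (px py : 'I_n -> nat).
Hypotheses (px_inj : injective px) (py_inj : injective py).

Definition point_mx (x y : nat) : nat :=
  [exists o : 'I_n, [&& px o == x, py o == y & x + y < n]].

Lemma point_mxP x y :
  reflect (exists o, [/\ px o = x, py o = y & x + y < n]) (0 < point_mx x y).
Proof.
rewrite /point_mx lt0b; apply: (iffP existsP) => -[o].
  by case/and3P => /eqP ? /eqP ? ?; exists o.
by case=> ex ey lt; exists o; rewrite ex ey !eqxx lt.
Qed.

Lemma partial_perm_point_mx : partial_perm point_mx.
Proof.
split=> [x y|x y y'|x x' y]; first exact: leq_b1.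
- move=> /point_mxP[o [<- <- _]] /point_mxP[o' [e <- _]].
  by rewrite (px_inj e).
- move=> /point_mxP[o [<- <- _]] /point_mxP[o' [<- e _]].
  by rewrite (py_inj e).
Qed.

Lemma staircase_point_mx : staircase n point_mx.
Proof.
move=> x y le; apply/eqP; rewrite -leqn0 leqNgt; apply/negP.
by move=> /point_mxP[o [_ _]]; lia.
Qed.

Definition decreasing_set (A : {set 'I_n}) : Prop :=
  forall a b, a \in A -> b \in A -> py a < py b -> px b < px a.

Definition increasing_set (A : {set 'I_n}) : Prop :=
  forall a b, a \in A -> b \in A -> py a < py b -> px a < px b.

(** Over all pairs, this places the far corner [(max px, max py)] of the bounding rectangle in the
    staircase. *)
Definition rectangular_set (A : {set 'I_n}) : Prop :=
  forall a b, a \in A -> b \in A -> px a + py b < n.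

Lemma set_top k (A : {set 'I_n}) : k < #|A| ->
  exists o, [/\ o \in A, k <= #|A :\ o|
              & forall a, a \in A :\ o -> a \in A /\ py a < py o].
Proof.
move=> lt; have /card_gt0P[o0 o0A] : 0 < #|A| by lia.
case: (arg_maxnP py o0A) => o oA0 omax; have oA : o \in A := oA0; exists o; split=> //.
  by move: lt; rewrite (cardsD1 o) oA add1n ltnS.
move=> a /setD1P[/eqP ne aA]; split=> //.
have nep : py a <> py o by move/py_inj.
by have := omax a aA; lia.
Qed.

Lemma dec_chain_of_set X k x0 y0 (A : {set 'I_n}) : k <= #|A| ->
  decreasing_set A -> rectangular_set A ->
  (forall a, a \in A -> x0 <= px a < X /\ py a < y0) ->
  dec_chain point_mx X k x0 y0.
Proof.
elim: k x0 y0 A => [//|k IHk] x0 y0 A /set_top[o [oA le top]] dec rect box.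
have [xo yo] := box o oA.
exists (px o), (py o); split=> //.
  by apply/point_mxP; exists o; split=> //; apply: rect.
apply: (IHk _ _ _ le) => [a b /top[aA _] /top[bA _]|a b /top[aA _] /top[bA _]|a].
- exact: dec.
- exact: rect.
- by move=> /top[aA lt]; have := dec _ _ aA oA lt; have [] := box a aA; lia.
Qed.

Lemma set_of_dec_chain X k x0 y0 : dec_chain point_mx X k x0 y0 ->
  exists A : {set 'I_n}, [/\ #|A| = k, decreasing_set A
    & forall a, a \in A -> x0 <= px a < X /\ py a < y0].
Proof.
elim: k x0 y0 => [|k IHk] x0 y0 /=.
  by exists set0; split=> [|a b|a]; rewrite ?cards0 ?inE.
case=> x [y [xP yP /point_mxP[o [ex ey _]] /IHk[A [cA dec box]]]].
subst x y; exists (o |: A); split=> [|a b|a].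
- rewrite cardsU1 cA; case: (boolP (o \in A)) => // /box[]; lia.
- case/setU1P=> [->|aA] /setU1P[->|bA]; first by rewrite ltnn.
  + by have [] := box b bA; lia.
  + by have [] := box a aA; lia.
  + exact: dec.
- by case/setU1P=> [->|/box[]]; lia.
Qed.

Lemma inc_chain_of_set k X Y (A : {set 'I_n}) : k <= #|A| ->
  increasing_set A -> rectangular_set A ->
  (forall a, a \in A -> px a < X /\ py a < Y) ->
  inc_chain point_mx k X Y.
Proof.
elim: k X Y A => [//|k IHk] X Y A /set_top[o [oA le top]] inc rect box.
have [xo yo] := box o oA.
exists (px o), (py o); split=> //.
  by apply/point_mxP; exists o; split=> //; apply: rect.
apply: (IHk _ _ _ le) => [a b /top[aA _] /top[bA _]|a b /top[aA _] /top[bA _]|a].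
- exact: inc.
- exact: rect.
- by move=> /top[aA lt]; have := inc _ _ aA oA lt.
Qed.

Lemma set_of_inc_chain k X Y : inc_chain point_mx k X Y ->
  exists A : {set 'I_n}, [/\ #|A| = k, increasing_set A
    & forall a, a \in A -> px a < X /\ py a < Y].
Proof.
elim: k X Y => [|k IHk] X Y /=.
  by exists set0; split=> [|a b|a]; rewrite ?cards0 ?inE.
case=> x [y [xP yP /point_mxP[o [ex ey _]] /IHk[A [cA inc box]]]].
subst x y; exists (o |: A); split=> [|a b|a].
- rewrite cardsU1 cA; case: (boolP (o \in A)) => // /box[]; lia.
- case/setU1P=> [->|aA] /setU1P[->|bA]; first by rewrite ltnn.
  + by have [] := box b bA; lia.
  + by have [] := box a aA; lia.
  + exact: inc.
- by case/setU1P=> [->|/box[]]; lia.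
Qed.

Lemma rectangular_box (A : {set 'I_n}) : 0 < #|A| -> rectangular_set A ->
  exists X, exists2 Y, X + Y = n.+1 & forall a, a \in A -> px a < X /\ py a < Y.
Proof.
move=> /card_gt0P[o0 o0A] rect.
case: (arg_maxnP px o0A) => o oA omax.
have lt := rect _ _ oA oA.
(* With [px o] maximal, this is the tallest rectangle of that width in the staircase. *)
exists (px o).+1, (n - px o) => [|a aA]; first lia.
by have := omax a aA; have := rect _ _ oA aA; lia.
Qed.

Lemma box_rectangular X Y (A : {set 'I_n}) : X + Y = n.+1 ->
  (forall a, a \in A -> px a < X /\ py a < Y) -> rectangular_set A.
Proof. by move=> e box a b /box[? _] /box[_ ?]; lia. Qed.

(** The maximal rectangles of the staircase are those with far corner on [X + Y = n.+1], so the
    outer boundary already records all chains spanning a rectangle. *)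
Lemma decreasing_lam k :
  (exists A, [/\ decreasing_set A, rectangular_set A & k < #|A|]) <->
  (exists X, exists2 Y, X + Y = n.+1 & 0 < lam point_mx k X Y).
Proof.
split=> [[A [dec rect lt]]|[X [Y e]]].
  have [|X [Y e box]] := rectangular_box _ rect; first lia.
  exists X, Y => //; apply/(lam_dec_chain _ _ _ partial_perm_point_mx).
  by apply: dec_chain_of_set lt dec rect _ => a /box[]; lia.
move=> /(lam_dec_chain _ _ _ partial_perm_point_mx) /set_of_dec_chain[A [cA dec box]].
exists A; split=> //; last by rewrite cA.
by apply: box_rectangular e _ => a /box[]; lia.
Qed.

Lemma increasing_lam k :
  (exists A, [/\ increasing_set A, rectangular_set A & k < #|A|]) <->
  (exists X, exists2 Y, X + Y = n.+1 & k < lam point_mx 0 X Y).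
Proof.
split=> [[A [inc rect lt]]|[X [Y e]]].
  have [|X [Y e box]] := rectangular_box _ rect; first lia.
  exists X, Y => //; apply/(lis_inc_chain k.+1 X Y partial_perm_point_mx).
  exact: inc_chain_of_set lt inc rect box.
move=> /(lis_inc_chain k.+1 X Y partial_perm_point_mx) /set_of_inc_chain[A [cA inc box]].
exists A; split=> //; last by rewrite cA.
exact: box_rectangular e box.
Qed.

End PointMatrix.

(** * Arcs of a permutation as points of two staircases *)

Section Permutations.
Variable n : nat.
Implicit Types (s : {perm 'I_n}) (A : {set 'I_n}).

(* The arc o -> s o is put in cell (n-1-s o, o) when it is upper, and in cell
   (s o, n-o) when it is lower: in both cases the arcs of the given kind are
   those falling in the staircase x + y < n, crossings are the decreasing
   sets spanning a rectangle of the staircase, and nestings the increasing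
   ones. *)
Definition upper_x s (o : 'I_n) : nat := n.-1 - s o.
Definition upper_y (o : 'I_n) : nat := o.
Definition lower_x s (o : 'I_n) : nat := s o.
Definition lower_y (o : 'I_n) : nat := n - o.

Definition upper_mx s := point_mx (upper_x s) upper_y.
Definition lower_mx s := point_mx (lower_x s) lower_y.

Lemma upper_x_inj s : injective (upper_x s).
Proof.
move=> o o'; rewrite /upper_x => e; apply: (@perm_inj _ s); apply: val_inj => /=.
by have := ltn_ord (s o); have := ltn_ord (s o'); lia.
Qed.

Lemma upper_y_inj : injective upper_y.
Proof. exact: val_inj. Qed.

Lemma lower_x_inj s : injective (lower_x s).
Proof. by move=> o o' e; apply: (@perm_inj _ s); apply: val_inj. Qed.

Lemma lower_y_inj : injective lower_y.
Proof.
move=> o o'; rewrite /lower_y => e; apply: val_inj => /=.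
by have := ltn_ord o; have := ltn_ord o'; lia.
Qed.

Lemma forall2_inP A (P : 'I_n -> 'I_n -> bool) :
  reflect (forall a b, a \in A -> b \in A -> P a b)
          [forall a in A, forall b in A, P a b].
Proof.
apply: (iffP forall_inP) => [h a b aA bA|h a aA]; first exact: (forall_inP (h a aA)).
by apply/forall_inP => b; apply: h.
Qed.

Lemma upper_crossingP s A : upper_crossing s A <->
  decreasing_set (upper_x s) upper_y A /\ rectangular_set (upper_x s) upper_y A.
Proof.
split=> [/forall2_inP h|[dec rect]].
  by split=> a b aA bA; have := h a b aA bA; rewrite /upper_x /upper_y;
     have := ltn_ord (s a); have := ltn_ord (s b); lia.
apply/forall2_inP => a b aA bA; have := dec a b aA bA; have := rect a b aA bA.
by rewrite /upper_x /upper_y; have := ltn_ord (s a); have := ltn_ord (s b); lia.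
Qed.

Lemma upper_nestingP s A : upper_nesting s A <->
  increasing_set (upper_x s) upper_y A /\ rectangular_set (upper_x s) upper_y A.
Proof.
split=> [/forall2_inP h|[inc rect]].
  by split=> a b aA bA; have := h a b aA bA; rewrite /upper_x /upper_y;
     have := ltn_ord (s a); have := ltn_ord (s b); lia.
apply/forall2_inP => a b aA bA; have := inc a b aA bA; have := rect a b aA bA.
by rewrite /upper_x /upper_y; have := ltn_ord (s a); have := ltn_ord (s b); lia.
Qed.

Lemma lower_crossingP s A : lower_crossing s A <->
  decreasing_set (lower_x s) lower_y A /\ rectangular_set (lower_x s) lower_y A.
Proof.
split=> [/forall2_inP h|[dec rect]].
  (* [lower_y] reverses the order of positions, so [a] and [b] exchange roles. *)
  by split=> a b aA bA; have := h b a bA aA; rewrite /lower_x /lower_y;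
     have := ltn_ord a; have := ltn_ord b; lia.
apply/forall2_inP => a b aA bA; have := dec b a bA aA; have := rect b a bA aA.
by rewrite /lower_x /lower_y; have := ltn_ord a; have := ltn_ord b; lia.
Qed.

Lemma lower_nestingP s A : lower_nesting s A <->
  increasing_set (lower_x s) lower_y A /\ rectangular_set (lower_x s) lower_y A.
Proof.
split=> [/forall2_inP h|[inc rect]].
  by split=> a b aA bA; have := h b a bA aA; rewrite /lower_x /lower_y;
     have := ltn_ord a; have := ltn_ord b; lia.
apply/forall2_inP => a b aA bA; have := inc b a bA aA; have := rect b a bA aA.
by rewrite /lower_x /lower_y; have := ltn_ord a; have := ltn_ord b; lia.
Qed.

Lemma Cr_lam s k : k < Cr s <->
  (exists X, exists2 Y, X + Y = n.+1 & 0 < lam (upper_mx s) k X Y) \/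
  (exists X, exists2 Y, X + Y = n.+1 & 0 < lam (lower_mx s) k X Y).
Proof.
have hU := decreasing_lam (@upper_x_inj s) upper_y_inj k.
have hL := decreasing_lam (@lower_x_inj s) lower_y_inj k.
split.
  move=> /lt_bigmax[A /orP[/upper_crossingP|/lower_crossingP] [dec rect] lt].
    by left; apply: (proj1 hU); exists A.
  by right; apply: (proj1 hL); exists A.
move=> h; apply/lt_bigmax.
case: h => [/(proj2 hU)|/(proj2 hL)] [A [dec rect lt]]; exists A => //.
  by apply/orP; left; apply/upper_crossingP.
by apply/orP; right; apply/lower_crossingP.
Qed.

Lemma Ne_lam s k : k < Ne s <->
  (exists X, exists2 Y, X + Y = n.+1 & k < lam (upper_mx s) 0 X Y) \/
  (exists X, exists2 Y, X + Y = n.+1 & k < lam (lower_mx s) 0 X Y).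
Proof.
have hU := increasing_lam (@upper_x_inj s) upper_y_inj k.
have hL := increasing_lam (@lower_x_inj s) lower_y_inj k.
split.
  move=> /lt_bigmax[A /orP[/upper_nestingP|/lower_nestingP] [inc rect] lt].
    by left; apply: (proj1 hU); exists A.
  by right; apply: (proj1 hL); exists A.
move=> h; apply/lt_bigmax.
case: h => [/(proj2 hU)|/(proj2 hL)] [A [inc rect lt]]; exists A => //.
  by apply/orP; left; apply/upper_nestingP.
by apply/orP; right; apply/lower_nestingP.
Qed.

Lemma upper_mx_arc s (o : 'I_n) : 0 < upper_mx s (n.-1 - s o) o <-> o <= s o.
Proof.
have lto := ltn_ord o; have ltso := ltn_ord (s o).
split=> [/point_mxP[_ [_ _]]|le]; first lia.
by apply/point_mxP; exists o; split=> //; lia.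
Qed.

Lemma lower_mx_arc s (o : 'I_n) : 0 < lower_mx s (s o) (n - o) <-> s o < o.
Proof.
have lto := ltn_ord o.
split=> [/point_mxP[_ [_ _]]|le]; first lia.
by apply/point_mxP; exists o; split=> //; lia.
Qed.

Lemma upper_mx_row s (o : 'I_n) : (exists x, 0 < upper_mx s x o) <-> o <= s o.
Proof.
split=> [[x /point_mxP[o' [ex /val_inj eo lt]]]|/upper_mx_arc].
  by subst o' x; have := ltn_ord (s o); rewrite /upper_x in lt *; lia.
by exists (n.-1 - s o).
Qed.

Lemma lower_mx_row s (o : 'I_n) :
  (exists x, 0 < lower_mx s x (n - o)) <-> s o < o.
Proof.
split=> [[x /point_mxP[o' [ex /lower_y_inj eo lt]]]|/lower_mx_arc].
  by subst o' x; have := ltn_ord o; rewrite /lower_x in lt *; lia.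
by exists (s o).
Qed.

Lemma upper_mx_col s (c : 'I_n) :
  (exists y, 0 < upper_mx s (n.-1 - c) y) <-> (s^-1)%g c <= c.
Proof.
have e : c = s ((s^-1)%g c) by rewrite permKV.
rewrite {1 3}e; set o := (s^-1)%g c; split=> [[y /point_mxP[o' [/upper_x_inj eo ey lt]]]|].
  by subst o' y; have := ltn_ord (s o); rewrite /upper_y in lt *; lia.
by move/upper_mx_arc; exists o.
Qed.

Lemma lower_mx_col s (c : 'I_n) :
  (exists y, 0 < lower_mx s c y) <-> c < (s^-1)%g c.
Proof.
have e : c = s ((s^-1)%g c) by rewrite permKV.
rewrite {1 2}e; set o := (s^-1)%g c; split=> [[y /point_mxP[o' [/lower_x_inj eo ey lt]]]|].
  by subst o' y; have := ltn_ord o; rewrite /lower_y in lt *; lia.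
by move/lower_mx_arc; exists (n - o).
Qed.

(** * The transposition map on permutations *)

Lemma eq_of_gt0 (a b : nat -> nat -> nat) : partial_perm a -> partial_perm b ->
  (forall x y, 0 < a x y <-> 0 < b x y) -> forall x y, a x y = b x y.
Proof.
move=> [a1 _ _] [b1 _ _] h x y; have := a1 x y; have := b1 x y.
by have [h1 h2] := h x y; lia.
Qed.

(* s' is obtained from s by transposing the partitions along the boundary of
   both staircases. *)
Definition transposed s s' : Prop :=
  [/\ degseq s' = degseq s,
      forall k x y, n <= x + y <= n.+1 ->
        lam (upper_mx s') k x y = conj_lam n (upper_mx s) k x y
    & forall k x y, n <= x + y <= n.+1 ->
        lam (lower_mx s') k x y = conj_lam n (lower_mx s) k x y].

(** The two fillings are transposed separately. Each keeps its nonempty rows and columns, so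
    together they still use every position once as a source and once as a target, and glue to a
    permutation. *)
Lemma transposed_exists s : exists s', transposed s s'.
Proof.
have pU := partial_perm_point_mx (@upper_x_inj s) upper_y_inj.
have pL := partial_perm_point_mx (@lower_x_inj s) lower_y_inj.
have [bU [pbU sbU rU cU lU]] :=
  transpose_filling pU (@staircase_point_mx n (upper_x s) upper_y).
have [bL [pbL sbL rL cL lL]] :=
  transpose_filling pL (@staircase_point_mx n (lower_x s) lower_y).
have stairU x y := @staircase_gt0 n _ x y sbU.
have stairL x y := @staircase_gt0 n _ x y sbL.
have rowU (o : 'I_n) x : 0 < bU x o -> o <= s o.
  by move=> h; apply/upper_mx_row/rU; exists x.
have rowL (o : 'I_n) x : 0 < bL x (n - o) -> s o < o.
  by move=> h; apply/lower_mx_row/rL; exists x.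
have [f fP] : exists f : 'I_n -> 'I_n, forall o,
    0 < bU (n.-1 - f o) o \/ 0 < bL (f o) (n - o).
  apply: (@fin_all_exists 'I_n (fun=> 'I_n) (fun o c => 0 < bU (n.-1 - c) o \/ 0 < bL c (n - o))).
  move=> o; have lto := ltn_ord o; have [le|lt] := leqP o (s o).
    have [x bx] : exists x, 0 < bU x o by apply/rU/upper_mx_row.
    have ltx : n.-1 - x < n by lia.
    exists (Ordinal ltx); left => /=.
    by rewrite subKn //; have := stairU _ _ bx; lia.
  have [x bx] : exists x, 0 < bL x (n - o) by apply/rL/lower_mx_row.
  have ltx : x < n by have := stairL _ _ bx; lia.
  by exists (Ordinal ltx); right.
(* No target is used by both fillings, since in [s] it belongs to an arc of a single kind. *)
have colUL (c : 'I_n) y y' : 0 < bU (n.-1 - c) y -> 0 < bL c y' -> False.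
  move=> hU hL.
  have le : (s^-1)%g c <= c by apply/upper_mx_col/cU; exists y.
  have : c < (s^-1)%g c by apply/lower_mx_col/cL; exists y'.
  by lia.
have [_ colU uniqU] := pbU; have [_ colL uniqL] := pbL.
have f_inj : injective f.
  move=> o o' e; have := fP o; have := fP o'; rewrite e.
  case=> [h'|h'] [h|h].
  - by apply: val_inj; apply: colU h h'.
  - by case: (colUL _ _ _ h' h).
  - by case: (colUL _ _ _ h h').
  - by apply: lower_y_inj; apply: colL h h'.
pose s' := perm f_inj.
have UE x y : upper_mx s' x y = bU x y.
  move: x y; apply: eq_of_gt0 => //.
    exact: partial_perm_point_mx (@upper_x_inj s') upper_y_inj.
  move=> x y; split=> [/point_mxP[o [<- <- lt]]|bxy].
    rewrite /upper_x /upper_y permE in lt *.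
    by case: (fP o) => // /stairL; have := ltn_ord (f o); have := ltn_ord o; lia.
  have ltxy := stairU _ _ bxy; have lty : y < n by lia.
  apply/point_mxP; exists (Ordinal lty); split=> //.
  rewrite /upper_x permE; case: (fP (Ordinal lty)) => [h|/rowL].
    exact: uniqU h bxy.
  by have := rowU (Ordinal lty) x bxy; lia.
have LE x y : lower_mx s' x y = bL x y.
  move: x y; apply: eq_of_gt0 => //.
    exact: partial_perm_point_mx (@lower_x_inj s') lower_y_inj.
  move=> x y; split=> [/point_mxP[o [<- <- lt]]|bxy].
    rewrite /lower_x /lower_y permE in lt *.
    by case: (fP o) => // /stairU; have := ltn_ord (f o); have := ltn_ord o; lia.
  have ltxy := stairL _ _ bxy.
  (* A nonempty row of [bL] is one of [lower_mx s], hence of the form [n - o]; this excludes row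
     0. *)
  have [_ /point_mxP[o [_ ey _]]] : exists x, 0 < lower_mx s x y.
    by apply/rL; exists x.
  subst y; apply/point_mxP; exists o; split=> //.
  rewrite /lower_x permE; case: (fP o) => [/rowU|h]; last exact: uniqL h bxy.
  by have := rowL o x bxy; lia.
exists s'; split=> [|k x y h|k x y h].
- apply/ffunP => v; rewrite !ffunE; congr (Posz (nat_of_bool _), Posz (nat_of_bool _)).
    apply/idP/idP => /upper_mx_col[y].
      by rewrite UE => h; apply/upper_mx_col/cU; exists y.
    move=> h; have [|y' h'] := proj2 (cU (n.-1 - v)); first by exists y.
    by apply/upper_mx_col; exists y'; rewrite UE.
  apply/idP/idP => /upper_mx_row[x].
    by rewrite UE; apply: rowU.
  move=> h; have [|x' h'] := proj2 (rU v); first by exists x.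
  by apply/upper_mx_row; exists x'; rewrite UE.
- by rewrite (eq_lam UE) lU.
- by rewrite (eq_lam LE) lL.
Qed.

Lemma eq_from_ltn (a b : nat) : (forall k, k < a <-> k < b) -> a = b.
Proof.
move=> h; apply/eqP; rewrite eqn_leq; apply/andP; split; rewrite leqNgt; apply/negP.
  by move/h; rewrite ltnn.
by move/h; rewrite ltnn.
Qed.

(** Part [k] of the conjugate is nonzero exactly when the first part exceeds [k]. *)
Lemma transposed_Cr s s' : transposed s s' -> Cr s' = Ne s.
Proof.
move=> [_ hU hL]; apply: eq_from_ltn => k.
suff e (a a' : nat -> nat -> nat) :
    (forall k x y, n <= x + y <= n.+1 -> lam a' k x y = conj_lam n a k x y) ->
    (exists X, exists2 Y, X + Y = n.+1 & 0 < lam a' k X Y) <->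
    (exists X, exists2 Y, X + Y = n.+1 & k < lam a 0 X Y).
  have := e _ _ hU; have := e _ _ hL; have := Cr_lam s' k; have := Ne_lam s k.
  by tauto.
move=> h; split=> -[X [Y eXY]] lt; exists X, Y => //; move: lt;
  by rewrite h ?conj_lamP //; lia.
Qed.

Lemma transposed_Ne s s' : transposed s s' -> Ne s' = Cr s.
Proof.
move=> [_ hU hL]; apply: eq_from_ltn => k.
suff e (a a' : nat -> nat -> nat) :
    (forall k x y, n <= x + y <= n.+1 -> lam a' k x y = conj_lam n a k x y) ->
    (exists X, exists2 Y, X + Y = n.+1 & k < lam a' 0 X Y) <->
    (exists X, exists2 Y, X + Y = n.+1 & 0 < lam a k X Y).
  have := e _ _ hU; have := e _ _ hL; have := Ne_lam s' k; have := Cr_lam s k.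
  by tauto.
move=> h; split=> -[X [Y eXY]]; rewrite ?h ?conj_lamP; try lia.
  by case/andP=> _ lt; exists X, Y.
move=> lt; exists X, Y => //; rewrite h ?conj_lamP ?lt ?andbT; last lia.
(* If [k > n], then [X <= n.+1 <= k] and part [k] vanishes. *)
by rewrite leqNgt; apply/negP => gt; move: lt; rewrite lam_big //; lia.
Qed.

Lemma conj_lam_inj a b x y : x <= n.+1 ->
  (forall k, conj_lam n a k x y = conj_lam n b k x y) ->
  forall k, lam a k x y = lam b k x y.
Proof.
move=> lex e k; have [lek|gtk] := leqP k n; last by rewrite !lam_big //; lia.
apply: eq_from_ltn => j.
by have := conj_lamP n a j k x y; have := conj_lamP n b j k x y; rewrite e lek /= => -> ->.
Qed.

(** Conjugation is injective, so the boundary partitions of [s1] and [s2] agree. They determine both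
    fillings, and every arc is visible in one of these. *)
Lemma transposed_inj s1 s2 s' : transposed s1 s' -> transposed s2 s' -> s1 = s2.
Proof.
move=> [_ hU1 hL1] [_ hU2 hL2].
have eU : forall x y, x + y < n -> upper_mx s1 x y = upper_mx s2 x y.
  apply: boundary_inj => k x y h; apply: conj_lam_inj => [|j]; first lia.
  by rewrite -hU1 // -hU2.
have eL : forall x y, x + y < n -> lower_mx s1 x y = lower_mx s2 x y.
  apply: boundary_inj => k x y h; apply: conj_lam_inj => [|j]; first lia.
  by rewrite -hL1 // -hL2.
apply/permP => o; have lto := ltn_ord o; have lts := ltn_ord (s1 o).
have [le|lt] := leqP o (s1 o).
  have /upper_mx_arc := le; rewrite eU; last lia.
  move=> /point_mxP[o' [ex /val_inj eo _]]; subst o'; apply: val_inj => /=.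
  by move: ex; have := ltn_ord (s2 o); rewrite /upper_x; lia.
have /lower_mx_arc := lt; rewrite eL; last lia.
move=> /point_mxP[o' [ex /lower_y_inj eo _]]; subst o'; apply: val_inj => /=.
by rewrite -ex.
Qed.

(** A choice of transposed permutations injects one set into the other; the reverse inequality is
    the same statement with [i] and [j] exchanged. *)
Lemma NC_le i j (D : {ffun 'I_n -> int * int}) : NC i j D <= NC j i D.
Proof.
have [f fP] := fin_all_exists transposed_exists.
have f_inj : injective f.
  by move=> s1 s2 e; apply: transposed_inj (fP s1) _; rewrite e; apply: fP.
rewrite /NC -(card_imset _ f_inj); apply: subset_leq_card.
apply/subsetP => _ /imsetP[s + ->]; rewrite !inE => /and3P[Ci Nj sD].
have [degE _ _] := fP s.
by rewrite (transposed_Cr (fP s)) (transposed_Ne (fP s)) degE Ci Nj sD.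
Qed.

End Permutations.

Theorem theorem1 (n : nat) (hn : 0 < n) (i j : int) (D : {ffun 'I_n -> int * int}) :
  NC i j D = NC j i D.
Proof. by apply/eqP; rewrite eqn_leq !NC_le. Qed.
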